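(* In the setting described in the context (a plane wave incident from air on a semi-infinite square array, of period $a$, of thin metallic wires standing in air, with reflection coefficient $\rho$), in the long wavelength limit $\beta a\ll\pi$, in which all the $\breve z_m$ and $\breve p_m$ with $m\ge 1$ are real and $\gamma_0$ is on the imaginary axis, $$\rho=-\frac{j\beta-\gamma_0}{j\beta+\gamma_0}\,\frac{\breve p_1-\gamma_0}{\breve p_1+\gamma_0}\,e^{2\gamma_0\delta},$$ $$\delta=\frac{1}{|\gamma_0|}\sum_{n=1}^\infty\left(\arctan\frac{|\gamma_0|}{\breve z_n}-\arctan\frac{|\gamma_0|}{\breve p_{n+1}}\right)\approx\sum_{n=1}^\infty\left(\frac1{\breve z_n}-\frac1{\breve p_{n+1}}\right),$$ where the approximate equality is valid if $\beta a\ll\pi$. Moreover, for $\beta a\ll\pi$ and $|\mathbf k_\parallel|a\ll\pi$, $$0\le\delta\le\sum_{n=1}^\infty\left(\frac1{\breve z_n}-\frac1{\breve z_{n+1}}\right)=\frac1{\breve z_1},$$ and, since $\breve z_1\approx 2\pi/a$, to a first approximation $$0\le\delta\le\frac{a}{2\pi}.$$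
   Context: Perfectly conducting wires of radius $r_w$, parallel to the $z$-axis and arranged in a square lattice of period $a$, occupy the half-space $z>0$; both the region $z<0$ and the space between the wires are air. The thin-wire approximation $r_w/a\ll 1$ is used: the surface current on each wire, for a mode of the unbounded array with wave vector $\mathbf k$, is $\frac{I}{2\pi r_w}e^{-j\mathbf k\cdot\mathbf r}\hat{\mathbf u}_z$, where $j$ is the imaginary unit. A plane wave with electric field amplitude $\mathbf E_0^{inc}$, free-space wave number $\beta=\omega/c$ and transverse wave vector $\mathbf k_\parallel=(k_x,k_y,0)$ is incident from $z<0$; $\mathbf E_0^{ref}$ is the amplitude, referred to the plane $z=0$, of the fundamental reflected plane wave, and $\rho=\frac{\mathbf E_0^{ref}\cdot\hat{\mathbf u}_z}{\mathbf E_0^{inc}\cdot\hat{\mathbf u}_z}$. Notation. For $\mathbf J=(j_1,j_2)\in\mathbb Z^2$ put $\mathbf k^0_{\mathbf J}=\frac{2\pi}{a}(j_1,j_2,0)$, $\mathbf k_{\mathbf J}=\mathbf k_\parallel+\mathbf k^0_{\mathbf J}$, $\gamma_{\mathbf J}=\sqrt{|\mathbf k_{\mathbf J}|^2-\beta^2}$, and $\gamma_0=\gamma_{(0,0)}$. The square root of a negative number $t$ is $j\sqrt{|t|}$. Numbers $\breve z_m$: let $|\mathbf k_{\mathbf J_m}|$, $m=1,2,\dots$, be the numbers $|\mathbf k_{\mathbf J}|$, $\mathbf J\ne(0,0)$, ordered so that $|\mathbf k_{\mathbf J_m}|\le|\mathbf k_{\mathbf J_{m+1}}|$; then $\breve z_m=\sqrt{|\mathbf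 k_{\mathbf J_m}|^2-\beta^2}$. Put also $\mathbf J_0=(0,0)$. Numbers $\breve p_n$: $\breve p_0=j\beta$ (TEM mode) and $\breve p_n=\sqrt{\beta_{n,TM}^2-\beta^2}$ for $n\ge 1$ (TM modes). Here $-\beta_{n,TM}^2$ are the eigenvalues of the two-dimensional Laplacian on Floquet functions of $(x,y)$ with transverse wave vector $\mathbf k_\parallel$ vanishing on the wire boundaries, with $\beta_{n,TM}^2$ increasing in $n$; within the thin-wire approximation $\lambda=\beta_{n,TM}^2$ are the solutions of $$\sum_{\mathbf J\in\mathbb Z^2}\frac{[J_0(|\mathbf k^0_{\mathbf J}|r_w)]^2}{|\mathbf k_{\mathbf J}|^2-\lambda}=0,$$ where $J_0$ is the Bessel function of order zero, and they satisfy $|\mathbf k_{\mathbf J_{n-1}}|^2\le\beta_{n,TM}^2\le|\mathbf k_{\mathbf J_n}|^2$ for $n\ge 1$. In particular, for real values, $\breve z_{m-1}\le\breve p_m\le\breve z_m$. All $\breve z_m$ and $\breve p_n$ are assumed, without loss of generality, to be different from zero. Starting point. The amplitudes $A_n$ of the modes excited in $z>0$ satisfy $\sum_n\frac{A_n}{\gamma_{\mathbf J}-\breve p_n}=(\mathbf E_0^{inc}\cdot\hat{\mathbf u}_z)\,\delta_{\mathbf J,\mathbf 0}$ for all $\mathbf J\in\mathbb Z^2$ (Kronecker symbol), the series $\sum_n\frac{A_n}{w-\breve p_n}$ is supposed absolutely convergent for $w$ different from all the $\breve p_n$, and the reflection coefficient is $$\rho=-\frac{\breve p_0-\gamma_0}{\breve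 p_0+\gamma_0}\prod_{n=1}^{\infty}\frac{\breve z_n+\gamma_0}{\breve z_n-\gamma_0}\,\frac{\breve p_n-\gamma_0}{\breve p_n+\gamma_0}.$$ *)

(* Defs.v *)
From Stdlib Require Import Reals ZArith List FinFun.
From Coquelicot Require Import Coquelicot.
Open Scope R_scope.

(* The square root of a negative number t is j sqrt |t|. *)
Definition csqrt (t : R) : C :=
  if Rle_dec 0 t then RtoC (sqrt t) else Cmult Ci (RtoC (sqrt (- t))).

Definition cexp (z : C) : C := (exp (Re z) * cos (Im z), exp (Re z) * sin (Im z)).

(* Bessel function of the first kind of order zero. *)
Definition besselJ0 (x : R) : R :=
  Series (fun m => (-1) ^ m / (INR (fact m)) ^ 2 * (x / 2) ^ (2 * m)).

(* u 1 * u 2 * ... * u N *)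
Fixpoint cprod (u : nat -> C) (N : nat) : C :=
  match N with
  | O => RtoC 1
  | S N' => Cmult (cprod u N') (u N)
  end.

(* Unconditional (equivalently, absolute) convergence of a real family. *)
Definition has_sum {T : Type} (f : T -> R) (l : R) : Prop :=
  forall eps, 0 < eps ->
  exists s0 : list T, forall s : list T, NoDup s -> incl s0 s ->
    Rabs (fold_right (fun x acc => f x + acc) 0 s - l) < eps.

Record wire_array := WireArray {
  period : R;
  radius : R;
  beta : R;                     (* free-space wave number omega / c *)
  kx : R;
  ky : R;
  ordJ : nat -> Z * Z;          (* m |-> J_m, with J_0 = (0,0) *)
  betaTM2 : nat -> R;           (* n |-> beta_{n,TM}^2; the value at 0 is unused *)
  amp : nat -> C;               (* amplitude A_n of the n-th mode *)
  Einc : C * C * C;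
  Eref : C * C * C
}.

Section Quantities.
Variable s : wire_array.

Definition k0norm (J : Z * Z) : R :=
  2 * PI / period s * sqrt (IZR (fst J) ^ 2 + IZR (snd J) ^ 2).

Definition kparnorm : R := sqrt (kx s ^ 2 + ky s ^ 2).

Definition knorm (J : Z * Z) : R :=
  sqrt ((kx s + 2 * PI / period s * IZR (fst J)) ^ 2
      + (ky s + 2 * PI / period s * IZR (snd J)) ^ 2).

Definition gamma (J : Z * Z) : C := csqrt (knorm J ^ 2 - beta s ^ 2).
Definition gamma0 : C := gamma (0%Z, 0%Z).

(* zb 0 is gamma0, since J_0 = (0,0). *)
Definition zb (m : nat) : C := gamma (ordJ s m).

Definition pb (n : nat) : C :=
  match n with
  | O => Cmult Ci (RtoC (beta s))
  | S _ => csqrt (betaTM2 s n - beta s ^ 2)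
  end.

Definition Einc_z : C := snd (Einc s).
Definition Eref_z : C := snd (Eref s).
Definition rho : C := Cdiv Eref_z Einc_z.

Definition dispersion (lam : R) : Prop :=
  (forall J, knorm J ^ 2 <> lam) /\
  has_sum (fun J => besselJ0 (k0norm J * radius s) ^ 2 / (knorm J ^ 2 - lam)) 0.

(* A superposition of the Floquet harmonics with |k_J|^2 = lam can vanish on
   the wires without any current on them when at least two such harmonics exist,
   or when one of them is not coupled to the wires.  Such lam are the
   eigenvalues that sit on a pole of the dispersion equation. *)
Definition currentless (lam : R) : Prop :=
  exists J, knorm J ^ 2 = lam /\
    (besselJ0 (k0norm J * radius s) = 0 \/
     exists J', J' <> J /\ knorm J' ^ 2 = lam).

Definition prod_factor (n : nat) : C :=
  Cmult (Cdiv (Cplus (zb n) gamma0) (Cminus (zb n) gamma0))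
        (Cdiv (Cminus (pb n) gamma0) (Cplus (pb n) gamma0)).

Record scattering : Prop := {
  period_pos : 0 < period s;
  radius_pos : 0 < radius s;
  wires_disjoint : 2 * radius s < period s;
  beta_pos : 0 < beta s;

  ordJ_inj : Injective (ordJ s);
  ordJ_surj : Surjective (ordJ s);
  ordJ_0 : ordJ s 0 = (0%Z, 0%Z);
  ordJ_sorted : forall m, (1 <= m)%nat -> knorm (ordJ s m) <= knorm (ordJ s (S m));

  (* multiplicities of the eigenvalues are fixed by the interlacing *)
  TM_complete : forall lam, dispersion lam -> exists n, (1 <= n)%nat /\ lam = betaTM2 s n;
  TM_sound : forall n, (1 <= n)%nat ->
    dispersion (betaTM2 s n) \/ currentless (betaTM2 s n);
  TM_sorted : forall n, (1 <= n)%nat -> betaTM2 s n <= betaTM2 s (S n);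
  TM_interlace : forall n, (1 <= n)%nat ->
    knorm (ordJ s (n - 1)) ^ 2 <= betaTM2 s n <= knorm (ordJ s n) ^ 2;

  (* m = 0 is included: gamma0 is a denominator in delta *)
  zb_neq0 : forall m, zb m <> RtoC 0;
  pb_neq0 : forall n, pb n <> RtoC 0;

  Einc_z_neq0 : Einc_z <> RtoC 0;
  (* As 1 / 0 = 0, a mode with pb n = gamma J (a currentless one, or the TEM mode
     at normal incidence) does not contribute to the equation for this J. *)
  amp_eq : forall J : Z * Z,
    is_series (V := C_R_NormedModule)
      (fun n => Cdiv (amp s n) (Cminus (gamma J) (pb n)))
      (if Z.eqb (fst J) 0 then if Z.eqb (snd J) 0 then Einc_z else RtoC 0
       else RtoC 0);
  amp_abs : forall w : C, (forall n, w <> pb n) ->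
    ex_series (fun n => Cmod (Cdiv (amp s n) (Cminus w (pb n))));
  rho_eq : exists P : C,
    filterlim (cprod prod_factor) eventually (locally P) /\
    rho = Cmult (Copp (Cdiv (Cminus (pb 0) gamma0) (Cplus (pb 0) gamma0))) P
}.

Definition zp_real : Prop :=
  forall m, (1 <= m)%nat -> Im (zb m) = 0 /\ Im (pb m) = 0.

Definition gamma0_imaginary : Prop := Re gamma0 = 0.

(* Below, the series over n >= 1 are shifted to start at 0.  Re serves to read
   zb and pb as real numbers. *)
Definition delta_term (n : nat) : R :=
  atan (Cmod gamma0 / Re (zb (S n))) - atan (Cmod gamma0 / Re (pb (S (S n)))).
Definition delta : R := / Cmod gamma0 * Series delta_term.

Definition delta_approx_term (n : nat) : R :=
  / Re (zb (S n)) - / Re (pb (S (S n))).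
Definition delta_approx : R := Series delta_approx_term.

Definition delta_bound_term (n : nat) : R :=
  / Re (zb (S n)) - / Re (zb (S (S n))).

End Quantities.

(* Main.v *)
Require Import Defs.
From Stdlib Require Import Reals ZArith List Lra Lia Classical.
From Coquelicot Require Import Coquelicot.
Open Scope R_scope.

(** With [gamma0 = j g] and [z] real, [(z + j g) / (z - j g)] is the phase factor of angle
    [2 atan (g / z)], so the infinite product without its factor [p_1] has as phase the sum of
    the [2 (atan (g / z_n) - atan (g / p_(n+1)))]: the leftover angle [2 atan (g / z_N)] vanishes
    because [z_N] tends to infinity. By the interlacing [z_n <= p_(n+1) <= z_(n+1)] this sum is
    dominated by a telescoping one, and [1 - X ^ 2 <= atan' <= 1] on [[0, X]] with [X = g / z_1]
    compares [delta] with its approximation.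

    The reality of [p_1] is the only delicate point. In the dispersion equation, the term of
    [J = 0] must balance all the others; if its root were below [beta ^ 2], this term would exceed
    [1 / beta ^ 2], while the others sum to [O(a ^ 2)] with a constant that depends on [r_w / a]. *)

(** * Increments of the arctangent and series with nonnegative terms *)

Lemma atan_sub_bounds (X x y : R) :
  0 <= y <= x -> x <= X -> (1 - X ^ 2) * (x - y) <= atan x - atan y <= x - y.
Proof.
intros [Hy Hyx] HxX.
destruct (Req_dec x y) as [->|Hne]; [lra|].
assert (Hlt : y < x) by lra.
destruct (MVT_cor2 atan (fun t => / (1 + t ^ 2)) y x Hlt) as [c [-> Hc]].
{ intros c _. apply is_derive_Reals. auto_derive; [easy|]. field. nra. }
assert (Hpos : 0 < 1 + c ^ 2) by nra.
assert (H1 : / (1 + c ^ 2) <= 1).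
{ rewrite <- Rinv_1. apply Rinv_le_contravar; nra. }
assert (H2 : 1 - X ^ 2 <= / (1 + c ^ 2)).
{ apply Rmult_le_reg_r with (1 + c ^ 2); [easy|].
  rewrite Rinv_l by lra.
  (* This is [c ^ 2 <= X ^ 2], whence [(1 - X ^ 2) * (1 + c ^ 2) <= 1]. *)
  assert (0 <= (X - c) * (X + c)) by (apply Rmult_le_pos; lra).
  nra. }
split; [apply Rmult_le_compat_r; lra | nra].
Qed.

Lemma Series_ge0 (a : nat -> R) :
  (forall n, 0 <= a n) -> ex_series a -> 0 <= Series a.
Proof.
intros Ha Hex.
replace 0 with (Series (fun n : nat => 0 * a n)) by (rewrite Series_scal_l; ring).
apply Series_le; [|easy]. intros n. specialize (Ha n). lra.
Qed.

Lemma ex_series_between0 (a b : nat -> R) :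
  (forall n, 0 <= a n <= b n) -> ex_series b -> ex_series a.
Proof.
intros Hab. apply (ex_series_le (K := R_AbsRing) (V := R_CompleteNormedModule)). intros n.
change (Rabs (a n) <= b n). destruct (Hab n). now rewrite Rabs_pos_eq.
Qed.

(** * Sums of differences over interlaced sequences *)

Section InterlacedSequences.

Variables (g : R) (z p : nat -> R).
Hypothesis g_pos : 0 < g.
Hypothesis z_pos : forall n, 0 < z n.
Hypothesis interlaced : forall n, z n <= p n <= z (S n).
Hypothesis z_infty : is_lim_seq z p_infty.

Let inv_diff n := / z n - / p n.
Let atan_diff n := atan (g / z n) - atan (g / p n).

Lemma is_lim_seq_inv_interlaced : is_lim_seq (fun n => / z n) 0.
Proof. apply (is_lim_seq_inv z p_infty); easy. Qed.

Lemma is_series_inv_telescope : is_series (fun n => / z n - / z (S n)) (/ z 0%nat).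
Proof.
assert (Hsum : forall n, sum_n (fun k => / z k - / z (S k)) n = / z 0%nat - / z (S n)).
{ induction n as [|n IH]; [now rewrite sum_O|].
  rewrite sum_Sn, IH. unfold plus; simpl. ring. }
change (is_lim_seq (sum_n (fun k => / z k - / z (S k))) (/ z 0%nat)).
apply is_lim_seq_ext with (fun n => / z 0%nat - / z (S n)); [easy|].
replace (Finite (/ z 0%nat)) with (Finite (/ z 0%nat - 0)) by (f_equal; ring).
apply is_lim_seq_minus'; [apply is_lim_seq_const|].
apply (is_lim_seq_incr_1 (fun n => / z n)), is_lim_seq_inv_interlaced.
Qed.

Lemma inv_diff_bounds n : 0 <= inv_diff n <= / z n - / z (S n).
Proof.
unfold inv_diff. destruct (interlaced n). pose proof (z_pos n).
pose proof (Rinv_le_contravar (z n) (p n)). pose proof (Rinv_le_contravar (p n) (z (S n))).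
lra.
Qed.

Lemma z_le_from_0 n : z 0%nat <= z n.
Proof. induction n; [lra|]. pose proof (interlaced n). lra. Qed.

Lemma atan_diff_bounds n :
  (1 - (g / z 0%nat) ^ 2) * (g * inv_diff n) <= atan_diff n <= g * inv_diff n.
Proof.
replace (g * inv_diff n) with (g / z n - g / p n).
2: { unfold inv_diff, Rdiv. ring. }
destruct (interlaced n). pose proof (z_pos n). pose proof (z_pos 0). pose proof (z_le_from_0 n).
apply atan_sub_bounds; repeat split.
- apply Rlt_le, Rdiv_lt_0_compat; lra.
- apply Rmult_le_compat_l; [lra|]. apply Rinv_le_contravar; lra.
- apply Rmult_le_compat_l; [lra|]. apply Rinv_le_contravar; lra.
Qed.

Lemma atan_diff_ge0 n : 0 <= atan_diff n.
Proof.
unfold atan_diff. destruct (interlaced n). pose proof (z_pos n).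
assert (Hle : g / p n <= g / z n).
{ apply Rmult_le_compat_l; [lra|]. apply Rinv_le_contravar; lra. }
destruct Hle as [Hlt | ->]; [|lra]. pose proof (atan_increasing _ _ Hlt). lra.
Qed.

Lemma ex_series_inv_diff : ex_series inv_diff.
Proof.
apply ex_series_between0 with (1 := inv_diff_bounds).
eexists; apply is_series_inv_telescope.
Qed.

Lemma ex_series_atan_diff : ex_series atan_diff.
Proof.
apply ex_series_between0 with (fun n => g * inv_diff n).
- intros n. split; [apply atan_diff_ge0 | apply atan_diff_bounds].
- apply (ex_series_scal_l g inv_diff), ex_series_inv_diff.
Qed.

(** All arguments of [atan] lie below [g / z 0], so one relative error, independent of [n], serves
    for every term and passes to the sum. *)
Lemma Series_atan_diff_bounds :
  (1 - (g / z 0%nat) ^ 2) * Series inv_diff <= / g * Series atan_diff <= Series inv_diff.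
Proof.
assert (Hg : 0 < / g) by now apply Rinv_0_lt_compat.
rewrite <- !Series_scal_l. pose proof ex_series_inv_diff as Hex.
assert (Ha : ex_series (fun n => / g * atan_diff n)).
{ apply (ex_series_scal_l (/ g) atan_diff), ex_series_atan_diff. }
assert (Hb : forall n, (1 - (g / z 0%nat) ^ 2) * inv_diff n <= / g * atan_diff n <= inv_diff n).
{ intros n. destruct (atan_diff_bounds n) as [H1 H2]. split; apply Rmult_le_reg_l with g; try easy;
  rewrite <- !Rmult_assoc, Rinv_r by lra; lra. }
split.
(* The factor [1 - (g / z 0) ^ 2] may be negative, whereas [Series_le] asks for nonnegative terms;
   the difference of the two series is compared with 0 instead. *)
- apply Rminus_le_0. rewrite <- Series_minus; [|apply Ha|apply (ex_series_scal_l _ inv_diff), Hex].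
  apply Series_ge0.
  + intros n. destruct (Hb n). lra.
  + apply (ex_series_minus (fun n => / g * atan_diff n)); [apply Ha|apply (ex_series_scal_l _ inv_diff), Hex].
- apply Series_le; [|easy]. intros n. split; [|apply Hb].
  apply Rmult_le_pos; [lra|apply atan_diff_ge0].
Qed.

Lemma Series_inv_diff_bounds : 0 <= Series inv_diff <= / z 0%nat.
Proof.
split; [apply Series_ge0; [apply inv_diff_bounds|apply ex_series_inv_diff]|].
rewrite <- (is_series_unique _ _ is_series_inv_telescope).
apply Series_le; [apply inv_diff_bounds|]. eexists; apply is_series_inv_telescope.
Qed.

Lemma Series_atan_diff_ge0 : 0 <= / g * Series atan_diff.
Proof.
apply Rmult_le_pos; [now apply Rlt_le, Rinv_0_lt_compat|].
apply Series_ge0; [apply atan_diff_ge0|apply ex_series_atan_diff].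
Qed.

End InterlacedSequences.

(** * Unordered sums and their finite partial sums *)

Section ListSums.

Variable T : Type.
Hypothesis T_dec : forall x y : T, {x = y} + {x <> y}.

Definition lsum (f : T -> R) (l : list T) : R :=
  fold_right (fun x acc => f x + acc) 0 l.

(** Isolates the term [J = 0] of the dispersion equation, the only one of negative sign when the
    root is below [beta ^ 2]. *)
Definition drop_at (x0 : T) (f : T -> R) (x : T) : R := if T_dec x x0 then 0 else f x.

Lemma lsum_le (f h : T -> R) l : (forall x, f x <= h x) -> lsum f l <= lsum h l.
Proof.
intros Hfh. induction l as [|x l IH]; simpl; [lra|]. specialize (Hfh x). lra.
Qed.

Lemma lsum_scal (c : R) (f : T -> R) l : lsum (fun x => c * f x) l = c * lsum f l.
Proof. induction l as [|x l IH]; simpl; [ring|]. rewrite IH. ring. Qed.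

Lemma lsum_ge0 (f : T -> R) l : (forall x, 0 <= f x) -> 0 <= lsum f l.
Proof. intros Hf. induction l as [|x l IH]; simpl; [lra|]. specialize (Hf x). lra. Qed.

Lemma lsum_app (f : T -> R) l1 l2 : lsum f (l1 ++ l2) = lsum f l1 + lsum f l2.
Proof. induction l1 as [|x l IH]; simpl; [ring|]. rewrite IH. ring. Qed.

Lemma lsum_incl (f : T -> R) l l' :
  (forall x, 0 <= f x) -> NoDup l -> incl l l' -> lsum f l <= lsum f l'.
Proof.
intros Hf Hl. revert l'. induction Hl as [|x l Hx Hl IH]; intros l' Hincl.
- now apply lsum_ge0.
- destruct (in_split x l') as [l1 [l2 ->]]; [apply Hincl; now left|].
  assert (H : lsum f l <= lsum f (l1 ++ l2)).
  { apply IH. intros y Hy. assert (y <> x) by (intros ->; easy).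
    assert (Hin : In y (l1 ++ x :: l2)) by (apply Hincl; now right).
    apply in_app_or in Hin. apply in_or_app. destruct Hin as [|[|]]; auto. congruence. }
  rewrite lsum_app in H |- *. simpl. lra.
Qed.

Lemma lsum_drop_at (x0 : T) (f : T -> R) l :
  NoDup l -> lsum f l = lsum (drop_at x0 f) l + (if in_dec T_dec x0 l then f x0 else 0).
Proof.
induction 1 as [|x l Hx Hl IH]; [simpl; lra|].
cbn [lsum fold_right]. fold (lsum f l) (lsum (drop_at x0 f) l). rewrite IH.
unfold drop_at at 2.
destruct (T_dec x x0) as [->|Hne], (in_dec T_dec x0 l), (in_dec T_dec x0 (_ :: l)) as [|Hn];
  try easy; try ring; exfalso; simpl in *; intuition.
Qed.

(** The unordered sum of a nonnegative family is the supremum of its finite sums. The least upper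
    bound form yields both uses made of the dispersion equation: every finite sum is at most
    [v - f x0], and any common bound of the finite sums is at least [v - f x0]. *)
Lemma has_sum_drop_at (x0 : T) (f : T -> R) (v : R) :
  (forall x, 0 <= drop_at x0 f x) -> has_sum f v ->
  is_lub (fun t => exists l, NoDup l /\ t = lsum (drop_at x0 f) l) (v - f x0).
Proof.
intros Hf Hsum.
assert (Happrox : forall eps l, 0 < eps -> exists l', NoDup l' /\ incl l l' /\
          Rabs (lsum (drop_at x0 f) l' - (v - f x0)) < eps).
{ intros eps l Heps. destruct (Hsum eps Heps) as [s0 Hs0].
  (* The list contains [s0] to be close to [v], [x0] so that [f x0] is counted, and [l] for the
     comparison by inclusion. *)
  pose (l' := nodup T_dec (x0 :: l ++ s0)).
  assert (Hin : incl (x0 :: l ++ s0) l') by (intros y; apply nodup_In).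
  assert (Hnd : NoDup l') by apply NoDup_nodup.
  exists l'. split; [easy|]. split.
  - intros y Hy. apply Hin. right. apply in_or_app. now left.
  - assert (Hs : incl s0 l').
    { intros y Hy. apply Hin. right. apply in_or_app. now right. }
    specialize (Hs0 l' Hnd Hs). fold (lsum f l') in Hs0.
    rewrite (lsum_drop_at x0 f l' Hnd) in Hs0.
    destruct (in_dec T_dec x0 l') as [_|Hn].
    + replace (_ - (v - f x0)) with (lsum (drop_at x0 f) l' + f x0 - v) by ring. exact Hs0.
    + elim Hn. apply Hin. now left. }
split.
- intros t [l [Hl ->]]. apply Rnot_lt_le. intros Hlt.
  destruct (Happrox (lsum (drop_at x0 f) l - (v - f x0)) l) as [l' [_ [Hincl Hl']]]; [lra|].
  pose proof (lsum_incl _ l l' Hf Hl Hincl). apply Rabs_def2 in Hl'. lra.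
- intros b Hb. apply Rnot_lt_le. intros Hlt.
  destruct (Happrox (v - f x0 - b) nil) as [l' [Hnd [_ Hl']]]; [lra|].
  assert (lsum (drop_at x0 f) l' <= b) by (apply Hb; now exists l').
  apply Rabs_def2 in Hl'. lra.
Qed.

End ListSums.

(** * Lattice wave vectors, evanescent harmonics and modes *)

Definition index_norm (J : Z * Z) : R := sqrt (IZR (fst J) ^ 2 + IZR (snd J) ^ 2).

Definition index_dec (J J' : Z * Z) : {J = J'} + {J <> J'}.
Proof. decide equality; apply Z.eq_dec. Defined.

Lemma index_norm_ge1 (J : Z * Z) : J <> (0%Z, 0%Z) -> 1 <= index_norm J.
Proof.
destruct J as [j1 j2]. intros HJ. unfold index_norm; simpl fst; simpl snd.
rewrite <- sqrt_1. apply sqrt_le_1_alt.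
replace (IZR j1 ^ 2 + IZR j2 ^ 2) with (IZR (j1 * j1 + j2 * j2)) by (rewrite plus_IZR, !mult_IZR; ring).
apply IZR_le.
assert (j1 <> 0 \/ j2 <> 0)%Z.
{ destruct (Z.eq_dec j1 0), (Z.eq_dec j2 0); [subst; easy| | |]; auto. }
nia.
Qed.

Section Array.

Variable s : wire_array.

Definition recip : R := 2 * PI / period s.

Lemma recip_pos : 0 < period s -> 0 < recip.
Proof. intros Ha. apply Rdiv_lt_0_compat; [pose proof PI_RGT_0; lra|easy]. Qed.

Lemma knorm_ge0 J : 0 <= knorm s J.
Proof. apply sqrt_pos. Qed.

Lemma kparnorm_ge0 : 0 <= kparnorm s.
Proof. apply sqrt_pos. Qed.

Lemma knorm_0 : knorm s (0%Z, 0%Z) = kparnorm s.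
Proof. unfold knorm, kparnorm; simpl. f_equal. ring. Qed.

Lemma knorm_sqr J :
  knorm s J ^ 2 = (kx s + recip * IZR (fst J)) ^ 2 + (ky s + recip * IZR (snd J)) ^ 2.
Proof.
unfold knorm. fold recip. rewrite pow2_sqrt; [easy|].
apply Rplus_le_le_0_compat; apply pow2_ge_0.
Qed.

Lemma cross_le J :
  Rabs (kx s * IZR (fst J) + ky s * IZR (snd J)) <= kparnorm s * index_norm J.
Proof.
unfold kparnorm, index_norm. rewrite <- !Rsqr_pow2.
apply Rabs_le. split; [|apply sqrt_cauchy].
pose proof (sqrt_cauchy (- kx s) (- ky s) (IZR (fst J)) (IZR (snd J))) as H.
rewrite <- !Rsqr_neg in H. lra.
Qed.

(** Triangle inequality in the plane, obtained by expanding the square and bounding the cross term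
    by Cauchy-Schwarz. *)
Lemma knorm_bounds J : 0 < period s ->
  recip * index_norm J - kparnorm s <= knorm s J <= recip * index_norm J + kparnorm s.
Proof.
intros Ha. pose proof (recip_pos Ha) as HK.
pose proof (knorm_ge0 J). pose proof kparnorm_ge0. pose proof (sqrt_pos (IZR (fst J) ^ 2 + IZR (snd J) ^ 2)) as Hn.
fold (index_norm J) in Hn.
destruct (Rabs_le_between (kx s * IZR (fst J) + ky s * IZR (snd J)) (kparnorm s * index_norm J)) as [Hc _].
specialize (Hc (cross_le J)).
assert (Hk : knorm s J ^ 2 = kparnorm s ^ 2 + (recip * index_norm J) ^ 2
         + 2 * recip * (kx s * IZR (fst J) + ky s * IZR (snd J))).
{ rewrite knorm_sqr, Rpow_mult_distr. unfold kparnorm, index_norm.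
  rewrite !pow2_sqrt by (apply Rplus_le_le_0_compat; apply pow2_ge_0). ring. }
assert (0 <= recip * index_norm J) by nra.
split; apply Rnot_lt_le; intros Hlt.
- assert (knorm s J ^ 2 < (recip * index_norm J - kparnorm s) ^ 2) by nra. nra.
- assert ((recip * index_norm J + kparnorm s) ^ 2 < knorm s J ^ 2) by nra. nra.
Qed.

(** The index shifts pair [z_1] with [p_2], [z_2] with [p_3] and so on; [p_1] stands apart. *)
Definition re_z (n : nat) : R := Re (zb s (S n)).
Definition re_p (n : nat) : R := Re (pb s (S (S n))).

Lemma csqrt_pos t : 0 < t -> csqrt t = RtoC (sqrt t).
Proof. intros Ht. unfold csqrt. destruct (Rle_dec 0 t); [easy|lra]. Qed.

Lemma csqrt_neg t : t < 0 -> csqrt t = (0, sqrt (- t)).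
Proof.
intros Ht. unfold csqrt. destruct (Rle_dec 0 t); [lra|].
unfold Cmult, Ci, RtoC; simpl. f_equal; ring.
Qed.

Lemma csqrt_0 : csqrt 0 = RtoC 0.
Proof. unfold csqrt. destruct (Rle_dec 0 0); [now rewrite sqrt_0|lra]. Qed.

Lemma csqrt_real_pos t : csqrt t <> RtoC 0 -> Im (csqrt t) = 0 -> 0 < t.
Proof.
intros Hn0 Him. destruct (Rtotal_order t 0) as [Hlt|[->|Hlt]]; [|now rewrite csqrt_0 in Hn0|easy].
rewrite csqrt_neg in Him by easy. simpl in Him.
pose proof (sqrt_lt_R0 (- t)). lra.
Qed.

Lemma csqrt_imag_neg t : csqrt t <> RtoC 0 -> Re (csqrt t) = 0 -> t < 0.
Proof.
intros Hn0 Hre. destruct (Rtotal_order t 0) as [Hlt|[->|Hlt]]; [easy|now rewrite csqrt_0 in Hn0|].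
rewrite csqrt_pos in Hre by easy. simpl in Hre.
pose proof (sqrt_lt_R0 t). lra.
Qed.

Hypothesis Hs : scattering s.

Lemma Cmod_gamma0_pos : 0 < Cmod (gamma0 s).
Proof.
apply Cmod_gt_0. pose proof (zb_neq0 s Hs 0) as H.
unfold zb in H. now rewrite (ordJ_0 s Hs) in H.
Qed.

Lemma ordJ_neq0 m : (1 <= m)%nat -> ordJ s m <> (0%Z, 0%Z).
Proof.
intros Hm Heq. rewrite <- (ordJ_0 s Hs) in Heq. apply (ordJ_inj s Hs) in Heq. lia.
Qed.

Lemma ordJ_le m n : (1 <= m <= n)%nat -> knorm s (ordJ s m) <= knorm s (ordJ s n).
Proof.
intros [Hm Hn]. induction Hn as [|n Hn IH]; [lra|].
apply Rle_trans with (1 := IH). apply (ordJ_sorted s Hs). lia.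
Qed.

Lemma knorm_J1_min J : J <> (0%Z, 0%Z) -> knorm s (ordJ s 1) <= knorm s J.
Proof.
intros HJ. destruct (ordJ_surj s Hs J) as [m <-]. apply ordJ_le. split; [lia|].
destruct m; [now rewrite (ordJ_0 s Hs) in HJ|lia].
Qed.

Lemma kparnorm_lt_beta : gamma0_imaginary s -> kparnorm s ^ 2 < beta s ^ 2.
Proof.
intros H. pose proof Cmod_gamma0_pos as Hg. apply Cmod_gt_0 in Hg.
unfold gamma0_imaginary, gamma0, gamma in *. rewrite knorm_0 in *.
apply csqrt_imag_neg in H; [lra|easy].
Qed.

Lemma gamma0_imaginary_eq : gamma0_imaginary s -> gamma0 s = (0, Cmod (gamma0 s)).
Proof.
intros H. pose proof (kparnorm_lt_beta H) as Hlt.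
unfold gamma0, gamma. rewrite knorm_0, csqrt_neg by lra.
f_equal. unfold Cmod; simpl fst; simpl snd.
rewrite pow_i, Rplus_0_l by lia. now rewrite sqrt_pow2 by apply sqrt_pos.
Qed.

(** Whether [gamma0] is real or imaginary, its squared modulus is the distance between two
    nonnegative numbers, hence at most the larger one. *)
Lemma gamma0_sqr_le : Cmod (gamma0 s) ^ 2 <= Rmax (kparnorm s ^ 2) (beta s ^ 2).
Proof.
unfold gamma0, gamma. rewrite knorm_0.
assert (H : Cmod (csqrt (kparnorm s ^ 2 - beta s ^ 2)) ^ 2 = Rabs (kparnorm s ^ 2 - beta s ^ 2)).
{ unfold csqrt. destruct (Rle_dec 0 _).
  - rewrite Cmod_R, pow2_abs, pow2_sqrt, Rabs_pos_eq; easy.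
  - rewrite Cmod_mult, Cmod_R, Rpow_mult_distr, pow2_abs, pow2_sqrt, Rabs_left by lra.
    replace (Cmod Ci) with 1; [ring|]. unfold Cmod, Ci; simpl fst; simpl snd.
    replace (0 ^ 2 + 1 ^ 2) with 1 by ring. now rewrite sqrt_1. }
rewrite H. pose proof (pow2_ge_0 (kparnorm s)). pose proof (pow2_ge_0 (beta s)).
pose proof (Rmax_l (kparnorm s ^ 2) (beta s ^ 2)). pose proof (Rmax_r (kparnorm s ^ 2) (beta s ^ 2)).
apply Rabs_le. lra.
Qed.

Section EvanescentModes.

Hypothesis evanescent : forall m, (1 <= m)%nat -> beta s ^ 2 < knorm s (ordJ s m) ^ 2.

Lemma zb_sqrt n : zb s (S n) = RtoC (sqrt (knorm s (ordJ s (S n)) ^ 2 - beta s ^ 2)).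
Proof. apply csqrt_pos. pose proof (evanescent (S n)). apply Rlt_0_minus, H. lia. Qed.

(** From the second TM mode on, the interlacing puts an evanescent harmonic below the mode. Below
    the first one it puts only [J = 0], so [p_1] escapes this argument. *)
Lemma betaTM2_bounds n :
  beta s ^ 2 < knorm s (ordJ s (S n)) ^ 2 <= betaTM2 s (S (S n)) /\
  betaTM2 s (S (S n)) <= knorm s (ordJ s (S (S n))) ^ 2.
Proof.
pose proof (TM_interlace s Hs (S (S n))) as H. pose proof (evanescent (S n)).
simpl Nat.sub in H. destruct H; [lia|]. repeat split; try easy. apply H0. lia.
Qed.

Lemma pb_sqrt n : pb s (S (S n)) = RtoC (sqrt (betaTM2 s (S (S n)) - beta s ^ 2)).
Proof. apply csqrt_pos. pose proof (betaTM2_bounds n). lra. Qed.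

Lemma zb_eq_re n : zb s (S n) = RtoC (re_z n).
Proof. unfold re_z. now rewrite zb_sqrt. Qed.

Lemma pb_eq_re n : pb s (S (S n)) = RtoC (re_p n).
Proof. unfold re_p. now rewrite pb_sqrt. Qed.

Lemma re_z_pos n : 0 < re_z n.
Proof.
unfold re_z. rewrite zb_sqrt. apply sqrt_lt_R0.
pose proof (betaTM2_bounds n). lra.
Qed.

Lemma re_interlaced n : re_z n <= re_p n <= re_z (S n).
Proof.
unfold re_z, re_p. rewrite !zb_sqrt, pb_sqrt.
pose proof (betaTM2_bounds n). split; apply sqrt_le_1_alt; lra.
Qed.

Lemma knorm_unbounded X : exists J, J <> (0%Z, 0%Z) /\ X <= knorm s J.
Proof.
pose proof (recip_pos (period_pos s Hs)) as HK.
set (y := Rabs ((X + kparnorm s) / recip)).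
assert (Hy : 0 <= y) by apply Rabs_pos.
assert (HXy : (X + kparnorm s) <= recip * y).
{ apply Rmult_le_reg_l with (/ recip); [now apply Rinv_0_lt_compat|].
  rewrite <- Rmult_assoc, Rinv_l, Rmult_1_l by lra.
  unfold y, Rdiv. rewrite Rmult_comm. apply Rle_abs. }
destruct (archimed y) as [Hup _].
exists (up y, 0%Z). split.
- intros [= Hup0]. rewrite Hup0 in Hup. simpl in Hup. lra.
- apply Rle_trans with (2 := proj1 (knorm_bounds (up y, 0%Z) (period_pos s Hs))).
  unfold index_norm; simpl fst; simpl snd.
  replace (IZR (up y) ^ 2 + 0 ^ 2) with (IZR (up y) ^ 2) by ring.
  rewrite sqrt_pow2 by lra. nra.
Qed.

Lemma re_z_mono m n : (m <= n)%nat -> re_z m <= re_z n.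
Proof. induction 1 as [|n _ IH]; [lra|]. pose proof (re_interlaced n). lra. Qed.

Lemma re_z_infty : is_lim_seq re_z p_infty.
Proof.
apply is_lim_seq_spec. intros M.
(* This bound is at least 1, hence at most its own square, so that [knorm s J ^ 2 - beta s ^ 2]
   exceeds [M ^ 2]. *)
destruct (knorm_unbounded (M ^ 2 + beta s ^ 2 + 1)) as [J [HJ0 HJ]].
destruct (ordJ_surj s Hs J) as [[|m] Hm]; [now rewrite (ordJ_0 s Hs) in Hm; subst J|].
exists m. intros n Hn. apply Rlt_le_trans with (2 := re_z_mono m n Hn).
unfold re_z. rewrite zb_sqrt, Hm. simpl Re.
apply Rle_lt_trans with (1 := Rle_abs M). rewrite <- sqrt_Rsqr_abs.
pose proof (pow2_ge_0 M). pose proof (pow2_ge_0 (beta s)).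
apply sqrt_lt_1_alt. rewrite Rsqr_pow2. split; nra.
Qed.

End EvanescentModes.

Lemma evanescent_of_real :
  (forall m, (1 <= m)%nat -> Im (zb s m) = 0) ->
  forall m, (1 <= m)%nat -> beta s ^ 2 < knorm s (ordJ s m) ^ 2.
Proof.
intros Hz m Hm. apply Rminus_lt_0, csqrt_real_pos; [|apply Hz, Hm].
apply (zb_neq0 s Hs m).
Qed.

(** * Estimates in the long wavelength limit *)

Section LongWavelength.

Variable eta : R.
Hypothesis eta_le : eta <= / 4.
Hypothesis Hbeta : beta s * period s < eta * PI.
Hypothesis Hkpar : kparnorm s * period s < eta * PI.

Lemma lt_recip x : x * period s < eta * PI -> x < eta / 2 * recip.
Proof.
intros Hx. pose proof (period_pos s Hs) as Ha. apply Rmult_lt_reg_r with (1 := Ha).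
replace (eta / 2 * recip * period s) with (eta * PI); [easy|]. unfold recip. field. lra.
Qed.

Lemma eta_pos : 0 < eta.
Proof.
pose proof (period_pos s Hs). pose proof (beta_pos s Hs). pose proof PI_RGT_0.
assert (0 < beta s * period s) by now apply Rmult_lt_0_compat. nra.
Qed.

(** Since [index_norm J >= 1], the shift by the incident wave vector is at most the fraction
    [eta / 2] of the reciprocal lattice vector. *)
Lemma knorm_small_bounds J : J <> (0%Z, 0%Z) ->
  (1 - eta / 2) * (recip * index_norm J) <= knorm s J <= (1 + eta / 2) * (recip * index_norm J).
Proof.
intros HJ. pose proof (lt_recip _ Hkpar). pose proof (index_norm_ge1 J HJ).
pose proof (recip_pos (period_pos s Hs)).
pose proof (knorm_bounds J (period_pos s Hs)). pose proof eta_pos.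
assert (eta / 2 * recip * 1 <= eta / 2 * recip * index_norm J).
{ apply Rmult_le_compat_l; nra. }
lra.
Qed.

Lemma evanescent_small m : (1 <= m)%nat -> beta s ^ 2 < knorm s (ordJ s m) ^ 2.
Proof.
intros Hm. pose proof (ordJ_neq0 m Hm) as HJ. pose proof (knorm_small_bounds _ HJ).
pose proof (index_norm_ge1 _ HJ). pose proof (lt_recip _ Hbeta). pose proof (beta_pos s Hs).
pose proof (recip_pos (period_pos s Hs)). pose proof eta_pos.
assert (recip * 1 <= recip * index_norm (ordJ s m)) by (apply Rmult_le_compat_l; lra).
assert (beta s < knorm s (ordJ s m)) by nra. nra.
Qed.

(** The upper bound compares [J_1] with [(1, 0)]. The lower one comes from [(1 - eta / 2) ^ 2 - (eta
    / 2) ^ 2 = 1 - eta >= (1 - eta) ^ 2]. *)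
Lemma re_z0_bounds : (1 - eta) * recip <= re_z 0 <= (1 + eta / 2) * recip.
Proof.
pose proof eta_pos. pose proof (recip_pos (period_pos s Hs)).
pose proof (lt_recip _ Hbeta). pose proof (beta_pos s Hs).
assert (H10 : (1%Z, 0%Z) <> (0%Z, 0%Z)) by easy.
pose proof (knorm_J1_min _ H10) as Hmin. pose proof (knorm_small_bounds _ H10) as H10b.
replace (index_norm (1%Z, 0%Z)) with 1 in H10b.
2: { unfold index_norm; simpl. replace (_ + _) with 1 by ring. now rewrite sqrt_1. }
assert (HJ1 : ordJ s 1 <> (0%Z, 0%Z)) by (apply ordJ_neq0; lia).
pose proof (knorm_small_bounds _ HJ1). pose proof (index_norm_ge1 _ HJ1).
assert (recip * 1 <= recip * index_norm (ordJ s 1)) by (apply Rmult_le_compat_l; lra).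
assert ((1 - eta / 2) * recip <= knorm s (ordJ s 1)) by nra.
assert (Hk : ((1 - eta / 2) * recip) ^ 2 <= knorm s (ordJ s 1) ^ 2) by (apply pow_incr; nra).
assert (Hb : beta s ^ 2 <= (eta / 2 * recip) ^ 2) by (apply pow_incr; lra).
unfold re_z. rewrite (zb_sqrt evanescent_small). simpl Re.
split.
- rewrite <- (sqrt_pow2 ((1 - eta) * recip)) by nra. apply sqrt_le_1_alt.
  assert (0 <= eta * (1 - eta) * recip ^ 2) by nra. nra.
- apply Rle_trans with (sqrt (knorm s (ordJ s 1) ^ 2)).
  + apply sqrt_le_1_alt. pose proof (pow2_ge_0 (beta s)). lra.
  + rewrite sqrt_pow2 by apply knorm_ge0. lra.
Qed.

(** The numerator is at most [eta / 2 * recip] and, as [eta <= / 4], the denominator is at least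
    [recip / 2]. *)
Lemma gamma0_ratio_sqr_le : (Cmod (gamma0 s) / re_z 0) ^ 2 <= eta ^ 2.
Proof.
pose proof (lt_recip _ Hbeta). pose proof (lt_recip _ Hkpar).
pose proof (beta_pos s Hs). pose proof kparnorm_ge0. pose proof re_z0_bounds. pose proof eta_pos.
pose proof (recip_pos (period_pos s Hs)). pose proof Cmod_gamma0_pos.
assert (Hg : Cmod (gamma0 s) ^ 2 <= (eta / 2 * recip) ^ 2).
{ apply Rle_trans with (1 := gamma0_sqr_le). apply Rmax_lub; apply pow_incr; lra. }
assert (Hle : Cmod (gamma0 s) <= eta / 2 * recip) by (apply Rnot_lt_le; intros Hlt; nra).
apply pow_incr. split; [apply Rlt_le, Rdiv_lt_0_compat; nra|].
apply Rle_div_l; nra.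
Qed.

End LongWavelength.

End Array.

(** * Phase factors and the infinite product *)

Definition cis (t : R) : C := (cos t, sin t).

Lemma cis_add (t u : R) : Cmult (cis t) (cis u) = cis (t + u).
Proof. unfold cis, Cmult; simpl. rewrite cos_plus, sin_plus. f_equal. ring. Qed.

Lemma cis_double_atan (x : R) :
  cis (2 * atan x) = ((1 - x ^ 2) / (1 + x ^ 2), 2 * x / (1 + x ^ 2)).
Proof.
assert (Hx : 0 < 1 + x ^ 2) by nra.
unfold cis. rewrite cos_2a, sin_2a, cos_atan, sin_atan, Rsqr_pow2.
assert (Hs : sqrt (1 + x ^ 2) * sqrt (1 + x ^ 2) = 1 + x ^ 2) by (apply sqrt_sqrt; lra).
assert (Hp : 0 < sqrt (1 + x ^ 2)) by now apply sqrt_lt_R0.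
set (q := sqrt (1 + x ^ 2)) in *.
rewrite <- Hs. f_equal; field; lra.
Qed.

Lemma Cdiv_conj_cis (x g : R) : 0 < x ->
  Cdiv (Cplus (RtoC x) (0, g)) (Cminus (RtoC x) (0, g)) = cis (2 * atan (g / x)).
Proof.
intros Hx. rewrite cis_double_atan.
unfold Cdiv, Cinv, Cminus, Cplus, Copp, Cmult, RtoC; simpl. f_equal; field; nra.
Qed.

Lemma Cdiv_conj_cis_opp (x g : R) : 0 < x ->
  Cdiv (Cminus (RtoC x) (0, g)) (Cplus (RtoC x) (0, g)) = cis (- (2 * atan (g / x))).
Proof.
intros Hx. replace (- (2 * atan (g / x))) with (2 * atan (- g / x)).
2: { unfold Rdiv. rewrite <- Ropp_mult_distr_l, atan_opp. ring. }
rewrite <- Cdiv_conj_cis by easy. unfold Cminus, Cplus, Copp; simpl. f_equal; f_equal; f_equal; ring.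
Qed.

(** Identifies the limit [P] that [rho_eq] provides: both components converge by continuity of [cos]
    and [sin], and real limits are unique. *)
Lemma filterlim_cis_limit (c P : C) (u : nat -> R) (v : nat -> C) (t : R) :
  (forall n, v n = Cmult c (cis (u n))) -> is_lim_seq u t ->
  filterlim v eventually (locally P) -> P = Cmult c (cis t).
Proof.
intros Hv Hu HP.
assert (Hcos : is_lim_seq (fun n => cos (u n)) (cos t)).
{ apply is_lim_seq_continuous; [apply continuity_cos|easy]. }
assert (Hsin : is_lim_seq (fun n => sin (u n)) (sin t)).
{ apply is_lim_seq_continuous; [apply continuity_sin|easy]. }
assert (HRe : is_lim_seq (fun n => Re (v n)) (Re P)).
{ apply filterlim_comp with (1 := HP). destruct P as [P1 P2]. apply (continuous_fst P1 P2). }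
assert (HIm : is_lim_seq (fun n => Im (v n)) (Im P)).
{ apply filterlim_comp with (1 := HP). destruct P as [P1 P2]. apply (continuous_snd P1 P2). }
assert (HRe' : is_lim_seq (fun n => Re (v n)) (Re (Cmult c (cis t)))).
{ apply is_lim_seq_ext with (fun n => Re c * cos (u n) - Im c * sin (u n)).
  { intros n. now rewrite Hv. }
  apply (is_lim_seq_minus' _ _ (Re c * cos t) (Im c * sin t)).
  - now apply (is_lim_seq_scal_l _ _ (cos t)).
  - now apply (is_lim_seq_scal_l _ _ (sin t)). }
assert (HIm' : is_lim_seq (fun n => Im (v n)) (Im (Cmult c (cis t)))).
{ apply is_lim_seq_ext with (fun n => Re c * sin (u n) + Im c * cos (u n)).
  { intros n. now rewrite Hv. }
  apply (is_lim_seq_plus' _ _ (Re c * sin t) (Im c * cos t)).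
  - now apply (is_lim_seq_scal_l _ _ (sin t)).
  - now apply (is_lim_seq_scal_l _ _ (cos t)). }
apply is_lim_seq_unique in HRe, HIm, HRe', HIm'. rewrite HRe in HRe'. rewrite HIm in HIm'.
injection HRe' as HRe'. injection HIm' as HIm'.
destruct P. unfold Re, Im in *. simpl fst in *; simpl snd in *. rewrite HRe', HIm'. reflexivity.
Qed.

Section ReflectionCoefficient.

Variable s : wire_array.
Hypothesis Hs : scattering s.
Hypothesis Hg : gamma0_imaginary s.
Hypothesis Hreal : zp_real s.

Let g := Cmod (gamma0 s).

Lemma evanescent_zp_real m : (1 <= m)%nat -> beta s ^ 2 < knorm s (ordJ s m) ^ 2.
Proof. apply evanescent_of_real; [easy|]. intros k Hk. now apply Hreal. Qed.

Let Hev := evanescent_zp_real.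

(** The product up to [n + 2] contains [z_1], ..., [z_(n+2)] and [p_1], ..., [p_(n+2)]. Pairing
    [z_k] with [p_(k+1)] leaves the factor of [p_1], kept outside, and the angle of [z_(n+2)]. *)
Definition phase (n : nat) : R :=
  2 * sum_n (delta_term s) n + 2 * atan (g / re_z s (S n)).

Lemma cprod_phase n :
  cprod (prod_factor s) (S (S n)) =
  Cmult (Cdiv (Cminus (pb s 1) (gamma0 s)) (Cplus (pb s 1) (gamma0 s))) (cis (phase n)).
Proof.
assert (Hz : forall n, Cdiv (Cplus (zb s (S n)) (gamma0 s)) (Cminus (zb s (S n)) (gamma0 s))
              = cis (2 * atan (g / re_z s n))).
{ intros k. rewrite (gamma0_imaginary_eq s Hs Hg), zb_eq_re by easy.
  apply Cdiv_conj_cis, re_z_pos; easy. }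
assert (Hp : forall n, Cdiv (Cminus (pb s (S (S n))) (gamma0 s)) (Cplus (pb s (S (S n))) (gamma0 s))
              = cis (- (2 * atan (g / re_p s n)))).
{ intros k. rewrite (gamma0_imaginary_eq s Hs Hg), pb_eq_re by easy.
  apply Cdiv_conj_cis_opp. pose proof (re_z_pos s Hs Hev k). pose proof (re_interlaced s Hs Hev k). lra. }
assert (Hd : forall n, delta_term s n = atan (g / re_z s n) - atan (g / re_p s n)) by easy.
induction n as [|n IH].
- cbn [cprod]. unfold prod_factor. rewrite !Hz, Hp, Cmult_1_l, (Cmult_comm (cis _) (Cdiv _ _)).
  rewrite <- Cmult_assoc, !cis_add. f_equal. f_equal.
  unfold phase. rewrite sum_O, Hd. unfold Rdiv. ring.
- change (cprod (prod_factor s) (S (S (S n)))) with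
    (Cmult (cprod (prod_factor s) (S (S n))) (prod_factor s (S (S (S n))))).
  rewrite IH. unfold prod_factor. rewrite Hz, Hp, <- Cmult_assoc, !cis_add. f_equal. f_equal.
  unfold phase. rewrite sum_Sn, Hd. unfold plus, Rdiv; simpl. ring.
Qed.

Lemma ex_series_delta_term : ex_series (delta_term s).
Proof.
apply (ex_series_atan_diff g (re_z s) (re_p s)); [now apply Cmod_gamma0_pos| | |].
- intros n. now apply re_z_pos.
- intros n. now apply re_interlaced.
- now apply re_z_infty.
Qed.

Lemma is_lim_seq_phase : is_lim_seq phase (2 * g * delta s).
Proof.
assert (Hg0 : 0 < g) by now apply Cmod_gamma0_pos.
replace (2 * g * delta s) with (2 * Series (delta_term s) + 2 * 0).
2: { unfold delta. fold g. field. lra. }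
apply is_lim_seq_plus'.
- apply (is_lim_seq_scal_l _ _ (Series (delta_term s))).
  apply Series_correct, ex_series_delta_term.
- apply (is_lim_seq_scal_l _ _ 0). rewrite <- atan_0. apply is_lim_seq_continuous.
  { apply derivable_continuous_pt, derivable_pt_atan. }
  replace 0 with (g * 0) by ring. apply (is_lim_seq_scal_l _ _ 0).
  apply (is_lim_seq_incr_1 (fun n => / re_z s n)).
  apply is_lim_seq_inv_interlaced, re_z_infty; easy.
Qed.

Lemma rho_delta :
  rho s =
    Cmult
      (Cmult
         (Copp (Cdiv (Cminus (Cmult Ci (RtoC (beta s))) (gamma0 s))
                     (Cplus (Cmult Ci (RtoC (beta s))) (gamma0 s))))
         (Cdiv (Cminus (pb s 1) (gamma0 s)) (Cplus (pb s 1) (gamma0 s))))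
      (cexp (Cmult (Cmult (RtoC 2) (gamma0 s)) (RtoC (delta s)))).
Proof.
destruct (rho_eq s Hs) as [P [HP ->]].
assert (Hexp : cexp (Cmult (Cmult (RtoC 2) (gamma0 s)) (RtoC (delta s))) = cis (2 * g * delta s)).
{ rewrite (gamma0_imaginary_eq s Hs Hg) at 1. fold g. unfold cexp, cis.
  replace (Cmult _ _) with ((0, 2 * g * delta s) : C).
  2: { unfold Cmult, RtoC; simpl. f_equal; ring. }
  simpl Re; simpl Im. rewrite exp_0. f_equal; ring. }
rewrite Hexp, <- Cmult_assoc. f_equal.
apply filterlim_cis_limit with (1 := cprod_phase) (2 := is_lim_seq_phase).
(* The closed form starts at two factors, so the convergence is read along [n + 2]. *)
apply filterlim_comp with (2 := HP).
apply filterlim_comp with (g := S) (f := S) (G := eventually); apply eventually_subseq; intros; lia.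
Qed.

End ReflectionCoefficient.

(** * Lower bound for the first TM eigenvalue *)

Lemma besselJ0_0 : besselJ0 0 = 1.
Proof.
unfold besselJ0. apply is_series_unique.
assert (Hsum : forall n, sum_n (fun m => (-1) ^ m / INR (fact m) ^ 2 * (0 / 2) ^ (2 * m)) n = 1).
{ induction n as [|n IH]; [rewrite sum_O; simpl; field|].
  rewrite sum_Sn, IH. replace (0 / 2) with 0 by field. rewrite pow_i by lia.
  unfold plus; simpl plus. rewrite Rmult_0_r. apply Rplus_0_r. }
change (is_lim_seq (sum_n (fun m => (-1) ^ m / INR (fact m) ^ 2 * (0 / 2) ^ (2 * m))) 1).
apply is_lim_seq_ext with (fun _ => 1); [easy|apply is_lim_seq_const].
Qed.

(** The terms [J <> 0] of the dispersion equation at zero wave vector and zero [lam], multiplied by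
    [recip ^ 2]: they depend on the array only through the ratio of radius to period. *)
Definition coupling (ratio : R) : Z * Z -> R :=
  drop_at _ index_dec (0%Z, 0%Z)
    (fun J => besselJ0 (2 * PI * ratio * index_norm J) ^ 2 / index_norm J ^ 2).

Lemma coupling_ge0 ratio J : 0 <= coupling ratio J.
Proof.
unfold coupling, drop_at. destruct (index_dec J _) as [|HJ]; [lra|].
pose proof (index_norm_ge1 J HJ).
apply Rdiv_le_0_compat; [apply pow2_ge_0|nra].
Qed.

Section LowestMode.

Variables (s : wire_array) (eta : R).
Hypothesis Hs : scattering s.
Hypothesis Hg : gamma0_imaginary s.
Hypothesis eta_le : eta <= / 4.
Hypothesis Hbeta : beta s * period s < eta * PI.

Lemma kpar_small : kparnorm s * period s < eta * PI.
Proof.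
pose proof (kparnorm_lt_beta s Hs Hg). pose proof (kparnorm_ge0 s). pose proof (beta_pos s Hs).
pose proof (period_pos s Hs). assert (kparnorm s < beta s) by nra. nra.
Qed.

Let Hkpar := kpar_small.
Let lam := betaTM2 s 1.
Let ratio := radius s / period s.
Let K := recip s.

Hypothesis lam_lt : lam < beta s ^ 2.

(** A currentless eigenvalue below [beta ^ 2] is impossible: the harmonic [J = 0] is coupled because
    [besselJ0 0 = 1], and any other harmonic, in particular one of two distinct ones, is evanescent,
    with [knorm ^ 2] above [beta ^ 2]. *)
Lemma lowest_mode_dispersion : dispersion s lam.
Proof.
pose proof (TM_sound s Hs 1 (le_n _)) as Hsound. fold lam in Hsound.
destruct Hsound as [H|[J [HJ [HJ0|[J' [HJ' Heq]]]]]]; [easy| |].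
- destruct (index_dec J (0%Z, 0%Z)) as [->|Hne].
  + replace (k0norm s (0%Z, 0%Z) * radius s) with 0 in HJ0.
    { rewrite besselJ0_0 in HJ0. lra. }
    unfold k0norm; simpl. rewrite !Rmult_0_l, Rplus_0_l, sqrt_0. ring.
  + destruct (ordJ_surj s Hs J) as [m <-].
    pose proof (evanescent_small s Hs eta eta_le Hbeta Hkpar m) as Hm.
    destruct m; [now rewrite (ordJ_0 s Hs) in Hne|]. rewrite HJ in Hm. specialize (Hm ltac:(lia)). lra.
- assert (Hne : exists m, (1 <= m)%nat /\ knorm s (ordJ s m) ^ 2 = lam).
  { destruct (ordJ_surj s Hs J) as [m Hm], (ordJ_surj s Hs J') as [m' Hm'].
    destruct m; [|exists (S m); split; [lia|congruence]].
    destruct m'; [congruence|exists (S m'); split; [lia|congruence]]. }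
  destruct Hne as [m [Hm Hkm]].
  pose proof (evanescent_small s Hs eta eta_le Hbeta Hkpar m Hm). lra.
Qed.

(** The opposite of the term [J = 0], which the other terms must balance. *)
Let D := / (lam - kparnorm s ^ 2).

(** The interlacing gives the weak lower inequality; it is strict because a root of the dispersion
    equation avoids its poles. *)
Lemma lowest_mode_gap : 0 < lam - kparnorm s ^ 2 < beta s ^ 2.
Proof.
destruct (TM_interlace s Hs 1 (le_n _)) as [H _]. simpl Nat.sub in H.
rewrite (ordJ_0 s Hs), knorm_0 in H. fold lam in H.
pose proof (proj1 lowest_mode_dispersion (0%Z, 0%Z)) as Hne. rewrite knorm_0 in Hne.
pose proof (pow2_ge_0 (kparnorm s)). lra.
Qed.

Let term J := besselJ0 (k0norm s J * radius s) ^ 2 / (knorm s J ^ 2 - lam).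

(** With [x = K * index_norm J] and [eta <= / 4], [knorm s J] lies between [7 / 8 * x] and
    [9 / 8 * x], while [0 < lam < (x / 8) ^ 2]. The denominator is thus between [x ^ 2 / 2] and
    [2 * x ^ 2]. *)
Lemma term_bounds J :
  / (2 * K ^ 2) * coupling ratio J <= drop_at _ index_dec (0%Z, 0%Z) term J
    <= 2 / K ^ 2 * coupling ratio J.
Proof.
unfold coupling, drop_at. destruct (index_dec J (0%Z, 0%Z)) as [|HJ]; [lra|].
pose proof (index_norm_ge1 J HJ) as Hn.
assert (HK : 0 < K) by (apply recip_pos, period_pos, Hs).
pose proof (period_pos s Hs).
unfold term. replace (k0norm s J * radius s) with (2 * PI * ratio * index_norm J).
2: { unfold k0norm, ratio. fold (index_norm J). field. lra. }
pose proof (knorm_small_bounds s Hs eta Hbeta Hkpar J HJ) as Hk. fold K in Hk.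
pose proof (lt_recip s Hs eta _ Hbeta) as Hb. fold K in Hb. pose proof (beta_pos s Hs).
pose proof (eta_pos s Hs eta Hbeta).
assert (K * 1 <= K * index_norm J) by (apply Rmult_le_compat_l; lra).
set (x := K * index_norm J) in *.
assert (Hlo : x ^ 2 / 2 <= knorm s J ^ 2 - lam).
{ assert ((7 / 8 * x) ^ 2 <= knorm s J ^ 2) by (apply pow_incr; nra).
  assert (beta s ^ 2 <= (/ 8 * x) ^ 2) by (apply pow_incr; nra). nra. }
assert (Hup : knorm s J ^ 2 - lam <= 2 * x ^ 2).
{ assert (knorm s J ^ 2 <= (9 / 8 * x) ^ 2) by (apply pow_incr; nra).
  pose proof lowest_mode_gap. pose proof (pow2_ge_0 (kparnorm s)). nra. }
assert (Hx : 0 < x ^ 2) by (apply pow_lt; lra).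
set (b := besselJ0 _ ^ 2). assert (Hb0 : 0 <= b) by apply pow2_ge_0.
replace (/ (2 * K ^ 2) * (b / index_norm J ^ 2)) with (b * / (2 * x ^ 2)).
2: { unfold x. field. lra. }
replace (2 / K ^ 2 * (b / index_norm J ^ 2)) with (b * / (x ^ 2 / 2)).
2: { unfold x. field. lra. }
split; (apply Rmult_le_compat_l; [easy|]); apply Rinv_le_contravar; lra.
Qed.

Lemma term_is_lub :
  is_lub (fun t => exists l, NoDup l /\ t = lsum _ (drop_at _ index_dec (0%Z, 0%Z) term) l) D.
Proof.
replace D with (0 - term (0%Z, 0%Z)).
- apply has_sum_drop_at; [|apply lowest_mode_dispersion].
  intros J. apply Rle_trans with (2 := proj1 (term_bounds J)).
  apply Rmult_le_pos; [|apply coupling_ge0].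
  assert (0 < K) by (apply recip_pos, period_pos, Hs).
  apply Rlt_le, Rinv_0_lt_compat. nra.
- unfold term, D. rewrite knorm_0.
  replace (k0norm s (0%Z, 0%Z) * radius s) with 0.
  + rewrite besselJ0_0. pose proof lowest_mode_gap. field. lra.
  + unfold k0norm; simpl. rewrite !Rmult_0_l, Rplus_0_l, sqrt_0. ring.
Qed.

Lemma coupling_sum_bounded l : NoDup l -> lsum _ (coupling ratio) l <= 2 * K ^ 2 * D.
Proof.
intros Hl. assert (0 < K) by (apply recip_pos, period_pos, Hs).
assert (H1 : / (2 * K ^ 2) * lsum _ (coupling ratio) l <= D).
{ rewrite <- lsum_scal. eapply Rle_trans; [apply lsum_le, term_bounds|].
  apply term_is_lub. now exists l. }
assert (0 < 2 * K ^ 2) by nra.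
apply Rmult_le_reg_l with (/ (2 * K ^ 2)); [now apply Rinv_0_lt_compat|].
rewrite <- Rmult_assoc, Rinv_l by lra. lra.
Qed.

(** The other terms sum to at most [2 * M / K ^ 2], and [D] exceeds [1 / beta ^ 2] by
    [lowest_mode_gap]. So a root below [beta ^ 2] forces a lower bound on [beta] times the period
    that depends on [M] alone. *)
Lemma recip_sqr_lt M :
  (forall l, NoDup l -> lsum _ (coupling ratio) l <= M) -> K ^ 2 < 2 * M * beta s ^ 2.
Proof.
intros HM. assert (HK : 0 < K) by (apply recip_pos, period_pos, Hs).
assert (HK2 : 0 < K ^ 2) by nra.
assert (HD : D <= 2 / K ^ 2 * M).
{ apply term_is_lub. intros t [l [Hl ->]].
  apply Rle_trans with (1 := lsum_le _ _ _ l (fun J => proj2 (term_bounds J))).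
  rewrite lsum_scal. apply Rmult_le_compat_l; [|auto].
  apply Rlt_le, Rdiv_lt_0_compat; lra. }
destruct lowest_mode_gap as [H1 H2].
assert (HD1 : 1 = D * (lam - kparnorm s ^ 2)) by (unfold D; field; lra).
assert (HD0 : 0 < D) by now apply Rinv_0_lt_compat.
assert (H3 : 1 < 2 / K ^ 2 * M * beta s ^ 2).
{ rewrite HD1. apply Rlt_le_trans with (D * beta s ^ 2); [nra|]. apply Rmult_le_compat_r; lra. }
apply Rmult_lt_compat_l with (1 := HK2) in H3.
replace (K ^ 2 * (2 / K ^ 2 * M * beta s ^ 2)) with (2 * M * beta s ^ 2) in H3 by (field; lra).
lra.
Qed.

End LowestMode.

(* In all arrays with a given [ratio] the terms of the dispersion equation are comparable to
   [coupling ratio], up to a factor [K ^ 2]. If the sums of [coupling ratio] are unbounded, then no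
   array has a dispersion root below [beta ^ 2]: the decay of the Bessel function is not needed. *)
Lemma lowest_mode_evanescent (ratio : R) :
  exists eta, 0 < eta <= / 4 /\
    forall s, scattering s -> gamma0_imaginary s -> radius s / period s = ratio ->
      beta s * period s < eta * PI -> beta s ^ 2 <= betaTM2 s 1.
Proof.
destruct (classic (exists M, forall l, NoDup l -> lsum _ (coupling ratio) l <= M)) as [[M HM]|Hun].
- assert (HM0 : 0 <= M) by (apply (HM nil), NoDup_nil).
  assert (H1M : 0 < / (1 + M)) by (apply Rinv_0_lt_compat; lra).
  (* With [beta < eta / 2 * recip], the bound [M * eta ^ 2 <= 1] gives
     [2 * M * beta ^ 2 < recip ^ 2], against [recip_sqr_lt]. *)
  exists (Rmin (/ 4) (/ (1 + M))). split; [split; [apply Rmin_glb_lt; lra|apply Rmin_l]|].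
  intros s Hs Hg <- Hbeta. apply Rnot_lt_le. intros Hlt.
  pose proof (Rmin_l (/ 4) (/ (1 + M))) as H4. pose proof (Rmin_r (/ 4) (/ (1 + M))) as HeM.
  set (eta := Rmin (/ 4) (/ (1 + M))) in *.
  pose proof (recip_sqr_lt s eta Hs Hg H4 Hbeta Hlt M HM) as HK.
  pose proof (lt_recip s Hs eta _ Hbeta) as Hb. pose proof (beta_pos s Hs).
  pose proof (eta_pos s Hs eta Hbeta). pose proof (recip_pos s (period_pos s Hs)).
  assert (HetaM : eta * (1 + M) <= 1).
  { apply Rmult_le_compat_r with (r := 1 + M) in HeM; [|lra]. rewrite Rinv_l in HeM; lra. }
  assert (Hb2 : beta s ^ 2 <= (eta / 2 * recip s) ^ 2) by (apply pow_incr; lra).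
  assert (2 * M * beta s ^ 2 <= 2 * M * (eta / 2 * recip s) ^ 2) by (apply Rmult_le_compat_l; lra).
  assert (HMe : M * eta * eta <= 1) by nra.
  assert (0 < recip s ^ 2) by nra.
  assert (M * eta * eta * recip s ^ 2 <= 1 * recip s ^ 2) by (apply Rmult_le_compat_r; lra).
  nra.
- exists (/ 4). split; [lra|]. intros s Hs Hg <- Hbeta. apply Rnot_lt_le. intros Hlt. apply Hun.
  eexists. intros l. apply (coupling_sum_bounded s (/ 4) Hs Hg (Rle_refl _) Hbeta Hlt).
Qed.

Lemma modes_real_of_evanescent (s : wire_array) :
  scattering s -> (forall m, (1 <= m)%nat -> beta s ^ 2 < knorm s (ordJ s m) ^ 2) ->
  forall m, (1 <= m)%nat -> Im (zb s m) = 0 /\ Im (pb s (S m)) = 0.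
Proof.
intros Hs Hev [|m] Hm; [lia|].
now rewrite zb_sqrt, pb_sqrt.
Qed.

(** Each approximation is stated with a relative error [eps] and a threshold [eta] for
    [beta a / pi]. The threshold for the reality of all modes, [p_1] included, depends on the ratio
    of radius to period; the others depend on [eps] only. The last regime includes real [gamma0],
    hence its own bound on [kparnorm]. *)
Theorem mainTheorem2 :
  (* for a given ratio r_w/a, zb m and pb m (m >= 1) are real if beta a << pi *)
  (forall ratio : R, exists eta : R, 0 < eta /\
     forall s : wire_array, scattering s -> gamma0_imaginary s ->
       radius s / period s = ratio -> beta s * period s < eta * PI ->
       zp_real s)
  /\
  (forall s : wire_array, scattering s -> gamma0_imaginary s -> zp_real s ->
     ex_series (delta_term s) /\
     rho s =
       Cmult
         (Cmult
            (Copp (Cdiv (Cminus (Cmult Ci (RtoC (beta s))) (gamma0 s))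
                        (Cplus (Cmult Ci (RtoC (beta s))) (gamma0 s))))
            (Cdiv (Cminus (pb s 1) (gamma0 s)) (Cplus (pb s 1) (gamma0 s))))
         (cexp (Cmult (Cmult (RtoC 2) (gamma0 s)) (RtoC (delta s)))))
  /\
  (forall eps : R, 0 < eps -> exists eta : R, 0 < eta /\
     (forall s : wire_array, scattering s -> gamma0_imaginary s ->
        beta s * period s < eta * PI ->
        (forall m, (1 <= m)%nat -> Im (zb s m) = 0 /\ Im (pb s (S m)) = 0) /\
        ex_series (delta_term s) /\
        ex_series (delta_approx_term s) /\
        Rabs (delta s - delta_approx s) <= eps * Rabs (delta_approx s))
     /\
     (forall s : wire_array, scattering s ->
        beta s * period s < eta * PI -> kparnorm s * period s < eta * PI ->
        (forall m, (1 <= m)%nat -> Im (zb s m) = 0 /\ Im (pb s (S m)) = 0) /\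
        ex_series (delta_term s) /\
        0 <= delta s <= Series (delta_bound_term s) /\
        is_series (delta_bound_term s) (/ Re (zb s 1)) /\
        Rabs (Re (zb s 1) - 2 * PI / period s) <= eps * (2 * PI / period s) /\
        0 <= delta s <= (1 + eps) * (period s / (2 * PI)))).
Proof.
split; [|split].
- intros ratio. destruct (lowest_mode_evanescent ratio) as [eta [[He0 He] H]].
  exists eta. split; [easy|]. intros s Hs Hg Hr Hbeta m Hm.
  pose proof (evanescent_small s Hs eta He Hbeta (kpar_small s eta Hs Hg Hbeta)) as Hev.
  split; [now apply modes_real_of_evanescent|].
  destruct m as [|[|m]]; [lia| |apply modes_real_of_evanescent; [easy|easy|lia]].
  (* Only [p_1] remains; a nonnegative radicand makes it real. *)
  specialize (H s Hs Hg Hr Hbeta).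
  simpl pb. unfold csqrt. destruct (Rle_dec 0 _); [easy|lra].
- intros s Hs Hg Hreal. split; [now apply ex_series_delta_term|now apply rho_delta].
(* The bound [/ 4] serves the long wavelength estimates; [eps / 2] gives [eta ^ 2 <= eps] and
   [/ (1 - eta) <= 1 + eps]. *)
- intros eps Heps. exists (Rmin (/ 4) (eps / 2)).
  assert (He0 : 0 < Rmin (/ 4) (eps / 2)) by (apply Rmin_glb_lt; lra).
  pose proof (Rmin_l (/ 4) (eps / 2)) as He4. pose proof (Rmin_r (/ 4) (eps / 2)) as Hee.
  set (eta := Rmin (/ 4) (eps / 2)) in *. split; [easy|]. split.
  + intros s Hs Hg Hbeta. pose proof (kpar_small s eta Hs Hg Hbeta) as Hkpar.
    pose proof (evanescent_small s Hs eta He4 Hbeta Hkpar) as Hev.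
    pose proof (Cmod_gamma0_pos s Hs) as Hg0.
    pose proof (re_z_pos s Hs Hev) as Hz. pose proof (re_interlaced s Hs Hev) as Hp.
    pose proof (re_z_infty s Hs Hev) as Hinf.
    split; [now apply modes_real_of_evanescent|].
    split; [now apply (ex_series_atan_diff _ (re_z s) (re_p s))|].
    split; [now apply (ex_series_inv_diff (re_z s) (re_p s))|].
    pose proof (Series_atan_diff_bounds _ (re_z s) (re_p s) Hg0 Hz Hp Hinf) as [Hlo Hup].
    pose proof (Series_inv_diff_bounds (re_z s) (re_p s) Hz Hp Hinf) as [Ha0 _].
    pose proof (gamma0_ratio_sqr_le s Hs eta He4 Hbeta Hkpar) as Hr.
    change (/ Cmod (gamma0 s) * Series _) with (delta s) in Hlo, Hup.
    change (Series (fun n => / re_z s n - / re_p s n)) with (delta_approx s) in Hlo, Hup, Ha0.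
    rewrite (Rabs_pos_eq (delta_approx s)) by easy.
    rewrite Rabs_minus_sym, Rabs_pos_eq by lra.
    assert (eta ^ 2 <= eps) by nra.
    apply Rle_trans with ((Cmod (gamma0 s) / re_z s 0) ^ 2 * delta_approx s); [lra|].
    apply Rmult_le_compat_r; lra.
  + intros s Hs Hbeta Hkpar.
    pose proof (evanescent_small s Hs eta He4 Hbeta Hkpar) as Hev.
    pose proof (Cmod_gamma0_pos s Hs) as Hg0.
    pose proof (re_z_pos s Hs Hev) as Hz. pose proof (re_interlaced s Hs Hev) as Hp.
    pose proof (re_z_infty s Hs Hev) as Hinf.
    split; [now apply modes_real_of_evanescent|].
    split; [now apply (ex_series_atan_diff _ (re_z s) (re_p s))|].
    pose proof (Series_atan_diff_bounds _ (re_z s) (re_p s) Hg0 Hz Hp Hinf) as [_ Hup].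
    pose proof (Series_inv_diff_bounds (re_z s) (re_p s) Hz Hp Hinf) as [_ Ha].
    pose proof (Series_atan_diff_ge0 _ (re_z s) (re_p s) Hg0 Hz Hp Hinf) as Hd0.
    pose proof (is_series_inv_telescope (re_z s) Hinf) as Htel.
    change (/ Cmod (gamma0 s) * Series _) with (delta s) in Hd0, Hup.
    change (is_series (delta_bound_term s) (/ re_z s 0)) in Htel.
    rewrite (is_series_unique _ _ Htel).
    pose proof (re_z0_bounds s Hs eta He4 Hbeta Hkpar) as Hz0.
    pose proof (recip_pos s (period_pos s Hs)) as HK. specialize (Hz 0%nat).
    fold (recip s). change (Re (zb s 1)) with (re_z s 0).
    assert (HeK : eta * recip s <= eps * recip s) by (apply Rmult_le_compat_r; lra).
    split; [lra|]. split; [easy|]. split; [apply Rabs_le; lra|]. split; [easy|].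
    replace (period s / (2 * PI)) with (/ recip s).
    2: { unfold recip. pose proof (period_pos s Hs). pose proof PI_RGT_0. field. lra. }
    apply Rle_trans with (/ re_z s 0); [lra|].
    apply Rle_trans with (/ ((1 - eta) * recip s)); [apply Rinv_le_contravar; [apply Rmult_lt_0_compat|]; lra|].
    rewrite Rinv_mult. apply Rmult_le_compat_r; [now apply Rlt_le, Rinv_0_lt_compat|].
    apply Rmult_le_reg_l with (1 - eta); [lra|]. rewrite Rinv_r by lra.
    assert (0 <= eps * (1 - 2 * eta)) by (apply Rmult_le_pos; lra). nra.
Qed.
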